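(* Let $G$ be a connected graph and let $t\geq 2$ be an integer. Then $2\leq \rho_{e}^o(G)\leq t$ if and only if $G$ satisfies all of the following conditions. \begin{itemize} \item $(C_1)$: $2\leq \operatorname{diam}(G)\leq 2t$. \item $(C_2)$: for every integer $s\geq t+1$, $G$ is $K_{1,s}$-free, i.e. $G$ contains no induced subgraph isomorphic to the star $K_{1,s}$. \item $(C_3)$: for every induced matching $M$ of $G$ with $|M|=t$ (if one exists), every vertex $z\in V(G)\setminus V(G[M])$ is adjacent to at least two vertices of $V(G[M])$. \item $(C_4)$: if $t\geq 3$, then for every $s$ with $2\leq s\leq t-1$, every partition $\{r_1,\dots,r_s\}$ of $t$ into $s$ parts with $1\leq r_1\leq r_2\leq\cdots\leq r_s$, and every edge open packing set $D^s$ of $G$ with $|D^s|=t$ such that $G[D^s]=D_1\cup D_2\cup\cdots\cup D_s$ where $D_1,\dots,D_s$ are the components of $G[D^s]$ and $D_i\cong K_{1,r_i}$ for each $i$, the following holds: for every vertex $z\in V(G)\setminus V(G[D^s])$ that is adjacent to the centre vertex $u_j$ of some component $D_j$ (if $D_j$ has only one edge, one of its end vertices is regarded as its centre), $z$ is adjacent to at least one vertex of $V(G[D^s])\setminus\{u_j\}$. \end{itemize}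
   Context: All graphs are finite and simple. For a graph $G$ and edges $e_1,e_2\in E(G)$, an edge $e\neq e_1,e_2$ is a common edge of $e_1$ and $e_2$ if $e$ joins an endpoint of $e_1$ to an endpoint of $e_2$. A set $D\subseteq E(G)$ is an edge open packing (EOP) set if no two distinct edges of $D$ have a common edge in $G$ (equivalently, for any two edges $e_1,e_2\in D$ there is no edge $e\in E(G)\setminus\{e_1,e_2\}$ such that the subgraph formed by $e_1,e,e_2$ is $P_4$ or $C_3$). The edge open packing number $\rho_e^o(G)$ is the maximum size of an EOP set of $G$. For $B\subseteq E(G)$, $G[B]$ denotes the subgraph of $G$ induced by the set of endpoints of edges in $B$. An induced matching is a matching $M$ such that no two edges of $M$ are joined by an edge of $G$. $\operatorname{diam}(G)$ is the diameter of $G$. *)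

(* Defs.v *)
From mathcomp Require Import all_boot.

Set Implicit Arguments.
Unset Strict Implicit.
Unset Printing Implicit Defensive.

Record sgraph := SGraph {
  vertex :> finType;
  adj : rel vertex;
  adj_sym : symmetric adj;
  adj_irr : irreflexive adj }.

Definition isomorphic_via (G H : sgraph) (f : G -> H) : Prop :=
  bijective f /\ forall x y : G, adj (f x) (f y) = adj x y.

Definition isomorphic (G H : sgraph) : Prop :=
  exists f : G -> H, isomorphic_via f.

(* The star K_{1,r}: the centre is [None], the leaves are the [Some i]. *)
Definition star_adj (r : nat) : rel (option 'I_r) := fun x y => isSome x (+) isSome y.

Lemma star_adj_sym r : symmetric (@star_adj r).
Proof. by move=> x y; rewrite /star_adj addbC. Qed.

Lemma star_adj_irr r : irreflexive (@star_adj r).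
Proof. by move=> x; rewrite /star_adj addbb. Qed.

Definition star (r : nat) : sgraph := SGraph (@star_adj_sym r) (@star_adj_irr r).

Section InducedSubgraph.
Variables (G : sgraph) (A : {set G}).

Definition induced_adj : rel {x : G | x \in A} := fun x y => adj (val x) (val y).

Lemma induced_adj_sym : symmetric induced_adj.
Proof. by move=> x y; rewrite /induced_adj adj_sym. Qed.

Lemma induced_adj_irr : irreflexive induced_adj.
Proof. by move=> x; rewrite /induced_adj adj_irr. Qed.

Definition induced : sgraph := SGraph induced_adj_sym induced_adj_irr.

End InducedSubgraph.

Section GraphNotions.
Variable G : sgraph.
Implicit Types (A : {set G}) (D M : {set {set G}}).

Definition connected_graph : Prop :=
  0 < #|G| /\ forall x y : G, connect (@adj G) x y.

Definition has_walk (x y : G) (n : nat) : bool :=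
  [exists p : n.-tuple G, path (@adj G) x p && (last x p == y)].

(* The least length of a walk from x to y.  A shortest walk has fewer than
   #|G| edges; if y is not reachable from x, the value is #|G|. *)
Definition dist (x y : G) : nat := find (has_walk x y) (iota 0 #|G|).

Definition diam : nat := \max_(x : G) \max_(y : G) dist x y.

Definition edges : {set {set G}} :=
  [set e | [exists x, exists y, adj x y && (e == [set x; y])]].

Definition common_edge (e1 e2 e : {set G}) : bool :=
  [&& e \in edges, e != e1, e != e2 &
      [exists x in e1, exists y in e2, e == [set x; y]]].

Definition eop D : bool :=
  (D \subset edges) &&
  [forall e1 in D, forall e2 in D,
     (e1 != e2) ==> ~~ [exists e, common_edge e1 e2 e]].

Definition eop_number : nat := \max_(D : {set {set G}} | eop D) #|D|.

(* For a set B of edges, V(G[B]) is [cover B], the union of the edges of B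
   as 2-element sets, and G[B] is [induced (cover B)]. *)

Definition matching M : bool := (M \subset edges) && trivIset M.

Definition induced_matching M : bool :=
  matching M &&
  [forall e1 in M, forall e2 in M,
     (e1 != e2) ==> [forall x in e1, forall y in e2, ~~ adj x y]].

Definition has_induced (H : sgraph) : Prop :=
  exists A : {set G}, isomorphic (induced A) H.

(* The vertex sets of the connected components of G[A]. *)
Definition components A : {set {set G}} :=
  equivalence_partition
    (connect [rel x y | [&& x \in A, y \in A & adj x y]]) A.

(* [u] is a centre of G[A], where G[A] is a star K_{1,r}.  It is unique for
   r >= 2, while for r = 1 both end vertices qualify. *)
Definition star_centre A (r : nat) (u : G) : Prop :=
  exists2 f : star r -> induced A, isomorphic_via f & val (f None) = u.

End GraphNotions.

(* Main.v *)
(* The edges of an EOP set D form disjoint induced stars without further edges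
   between them; we encode D by the leaf [l e] and the centre [c e] of each of its
   edges. If a vertex z outside D violates (C3) or (C4), an edge at z extends D; in
   (C3) this presupposes that z has a neighbour on the induced matching M, which
   holds by connectedness: if y has a neighbour on M and w is a neighbour of y
   without one, replacing each edge of M that meets N(y) by an edge at y, and adding
   yw, enlarges M. Conversely, let D be an EOP set of size t + 1. Deleting an edge e0
   leaves an EOP set of size t to which the leaf [l e0] is joined at most through
   [c e0]. This contradicts (C3) if the rest is an induced matching, and (C4) if it
   has at least two stars, one of them with two edges; if D is a single star, it
   contradicts (C2). *)
Require Import Defs.
From mathcomp Require Import all_boot.
From mathcomp Require Import zify.

Set Implicit Arguments.
Unset Strict Implicit.
Unset Printing Implicit Defensive.

(** * Distances and shortest paths *)

Section Distance.
Variable G : sgraph.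
Implicit Types x y : G.

Lemma has_walkP x y n :
  reflect (exists p : seq G, [/\ path (@adj G) x p, last x p = y & size p = n])
          (has_walk x y n).
Proof.
apply: (iffP existsP) => [[p /andP[xp /eqP yp]]|[p [xp yp sp]]].
  by exists p; rewrite size_tuple.
by exists (Tuple (introT eqP sp)); rewrite /= xp yp eqxx.
Qed.

(** [find] stops at the first length that admits a walk, and it never exceeds [#|G|], which settles
    the longer walks. *)
Lemma dist_le_walk x (p : seq G) :
  path (@adj G) x p -> dist x (last x p) <= size p.
Proof.
move=> xp; rewrite leqNgt; apply/negP => lt_p.
have lt_pG : size p < #|G|.
  by rewrite (leq_trans lt_p) // -[leqRHS](size_iota 0) find_size.
have := before_find 0 lt_p; rewrite nth_iota // add0n => /negbT/negP; apply.
by apply/has_walkP; exists p.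
Qed.

(** Connectedness gives a path without repeated vertices. It has fewer than [#|G|] edges, so the
    search defining [dist] succeeds. *)
Lemma dist_walk x y : connected_graph G ->
  exists p : seq G, [/\ path (@adj G) x p, last x p = y & size p = dist x y].
Proof.
move=> [_ /(_ x y)/connectP[p0 xp0 ->]].
case/shortenP: xp0 => p xp up _.
have lt_pG : size p < #|G| by have := max_card (mem (x :: p)); rewrite (card_uniqP up).
have hasp : has (has_walk x (last x p)) (iota 0 #|G|).
  apply/hasP; exists (size p); first by rewrite mem_iota.
  by apply/has_walkP; exists p.
have := nth_find 0 hasp; rewrite nth_iota; last by rewrite -[ltnRHS](size_iota 0) -has_find.
by move/has_walkP.
Qed.

Lemma dist_adj x y z : connected_graph G -> adj y z -> dist x z <= (dist x y).+1.
Proof.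
move=> Gc yz; have [p [xp yp <-]] := dist_walk x y Gc.
have := @dist_le_walk x (rcons p z); rewrite rcons_path last_rcons size_rcons xp yp.
by apply.
Qed.

(** A shortest path is given as a function on [nat], so that its vertices can be picked by index
    arithmetic; values beyond [dist x y] do not matter. *)
Lemma geodesic x y : connected_graph G ->
  exists p : nat -> G, [/\ p (dist x y) = y,
    forall i, i <= dist x y -> dist x (p i) = i &
    forall i, i < dist x y -> adj (p i) (p i.+1)].
Proof.
move=> Gc; move Ed: (dist x y) => d.
elim: d y Ed => [|d IHd] y Ed.
  by exists (fun=> y); split=> // i; rewrite leqn0 => /eqP->.
have [q [xq yq sq]] := dist_walk x y Gc.
case/lastP: q => [|q z] in xq yq sq *; first by rewrite Ed in sq.
move: xq yq sq; rewrite rcons_path last_rcons size_rcons => /andP[xq qz] zy sq; subst z.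
(* The predecessor of [y] on a shortest walk has distance exactly [d]: at most [d] by the walk [q],
   at least [d] because [y] is one step further. *)
have le_a := dist_le_walk xq; have le_z := dist_adj x Gc qz.
have da : dist x (last x q) = d by lia.
have [p [pda pd pa]] := IHd _ da.
exists (fun i => if i == d.+1 then y else p i); rewrite eqxx; split=> // i.
  by case: eqP => [-> //|neq_i le_i]; apply: pd; lia.
rewrite ltnS leq_eqVlt eqSS => /orP[/eqP->|lt_id].
  by rewrite eqxx (ltn_eqF (ltnSn d)) pda.
by rewrite !ltn_eqF ?pa // (leq_trans lt_id).
Qed.
End Distance.

(** * EOP sets as systems of disjoint induced stars *)

Section StarSystems.
Variable G : sgraph.
Implicit Types (D : {set {set G}}) (e : {set G}) (x y : G).

Lemma edgesP e : reflect (exists x y, adj x y /\ e = [set x; y]) (e \in edges G).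
Proof.
rewrite inE; apply: (iffP existsP) => [[x /existsP[y /andP[xy /eqP->]]]|[x [y [xy ->]]]].
  by exists x, y.
by exists x; apply/existsP; exists y; rewrite xy eqxx.
Qed.

Lemma edge_set2 x y : adj x y -> [set x; y] \in edges G.
Proof. by move=> xy; apply/edgesP; exists x, y. Qed.

Lemma card_edge e : e \in edges G -> #|e| = 2.
Proof.
case/edgesP=> x [y [xy ->]]; rewrite cards2; case: eqP xy => // ->.
by rewrite adj_irr.
Qed.

Lemma edge_eq_set2 e x y :
  e \in edges G -> x \in e -> y \in e -> x != y -> e = [set x; y].
Proof.
move=> /card_edge e2 xe ye xy; apply/esym/eqP.
by rewrite eqEcard e2 cards2 xy subUset !sub1set xe ye.
Qed.

(** Working form of the definition: any adjacency between ends of two edges of [D] is one of these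
    two edges. *)
Lemma eopP D :
  reflect (D \subset edges G /\
    forall e1 e2 x y, e1 \in D -> e2 \in D -> e1 != e2 -> x \in e1 -> y \in e2 ->
      adj x y -> [set x; y] = e1 \/ [set x; y] = e2) (eop D).
Proof.
apply: (iffP andP) => -[DE Deop]; split=> //.
  move=> e1 e2 x y De1 De2 ne12 xe1 ye2 xy.
  have /forall_inP/(_ e2 De2)/implyP/(_ ne12)/existsPn/(_ [set x; y]) :=
    forall_inP Deop e1 De1.
  rewrite /common_edge edge_set2 //=; case: eqP => [->|_]; first by left.
  case: eqP => [->|_]; first by right.
  by case/existsP; exists x; rewrite xe1; apply/existsP; exists y; rewrite ye2 eqxx.
apply/forall_inP=> e1 De1; apply/forall_inP=> e2 De2; apply/implyP=> ne12.
apply/existsPn=> e; apply/negP=> /and4P[Ee ne1 ne2].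
case/exists_inP=> x xe1 /exists_inP[y ye2 /eqP def_e].
(* The set [[set x; y]] is an edge, so it has two elements and its ends are adjacent in one of the
   two orders. *)
have xy : adj x y.
  have := card_edge Ee; rewrite def_e cards2.
  have /edgesP[a [b [ab ab_e]]] := Ee.
  case: eqP => // /eqP ne_xy _.
  have: x \in [set a; b] /\ y \in [set a; b] by rewrite -ab_e def_e set21 set22.
  rewrite !inE => -[/orP[]/eqP xE /orP[]/eqP yE]; move: ne_xy; rewrite xE yE ?eqxx //.
  by rewrite adj_sym.
have [E|E] := Deop _ _ _ _ De1 De2 ne12 xe1 ye2 xy.
  by rewrite def_e E eqxx in ne1.
by rewrite def_e E eqxx in ne2.
Qed.

Lemma eop_subset D D' : D' \subset D -> eop D -> eop D'.
Proof.
move=> /subsetP sD /eopP[DE Deop]; apply/eopP; split.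
  by apply/subsetP=> e /sD; apply/subsetP.
by move=> e1 e2 x y /sD De1 /sD De2; apply: Deop.
Qed.

(** Indices with equal centres form one star. The index type is arbitrary, so that systems can be
    built over edges, ordinals or an option type. *)
Definition star_system (I : finType) (A : {set I}) (l c : I -> G) : Prop :=
  {in A &, forall i j, [/\ adj (l i) (c j) = (c i == c j),
                          ~~ adj (l i) (l j) & ~~ adj (c i) (c j)]}.

Section OneSystem.
Variables (I : finType) (A : {set I}) (l c : I -> G).
Hypothesis lcA : star_system A l c.

Lemma star_system_adj i : i \in A -> adj (l i) (c i).
Proof. by move=> Ai; have [-> _ _] := lcA Ai Ai. Qed.

Lemma star_system_leaf_neq_centre i j : i \in A -> j \in A -> l i != c j.
Proof.
move=> Ai Aj; apply/eqP=> lc; have [_ _ /negP[]] := lcA Aj Ai.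
by rewrite -lc star_system_adj.
Qed.

(** Only leaf-centre pairs can be adjacent, and then the centres agree, so the pair is the edge of
    its own leaf. *)
Lemma star_system_eop : eop [set [set l i; c i] | i in A].
Proof.
apply/eopP; split.
  by apply/subsetP=> _ /imsetP[i Ai ->]; rewrite edge_set2 ?star_system_adj.
move=> _ _ x y /imsetP[i Ai ->] /imsetP[j Aj ->] _.
have [lc ll cc] := lcA Ai Aj; have [lc' _ _] := lcA Aj Ai.
rewrite !inE => /orP[]/eqP-> /orP[]/eqP->.
- by rewrite (negPf ll).
- by rewrite lc => /eqP->; left.
- by rewrite adj_sym lc' => /eqP<-; right; rewrite setUC.
by rewrite (negPf cc).
Qed.

(** The source of lower bounds on [eop_number]. A leaf is never a centre, so distinct leaves lie on
    distinct edges. *)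
Lemma star_system_leq : {in A &, injective l} -> #|A| <= eop_number G.
Proof.
move=> l_inj; rewrite -(card_in_imset (f := fun i => [set l i; c i])).
  by apply: leq_bigmax_cond; apply: star_system_eop.
move=> i j Ai Aj E; apply: l_inj => //.
have := set21 (l i) (c i); rewrite E !inE (negPf (star_system_leaf_neq_centre Ai Aj)) orbF.
by move/eqP.
Qed.

End OneSystem.

(* The leaf of an edge is an end vertex that lies on no other edge of [D]; it
   exists since three edges of [D] cannot form a path. *)
Lemma eop_star_system (x0 : G) D : eop D ->
  exists l c : {set G} -> G, [/\ {in D, forall e, e = [set l e; c e]},
    star_system D l c & {in D &, injective l}].
Proof.
move=> /eopP[DE Deop].
(* The leaf of an edge will be a [lone] end: one on no other edge of [D]. *)
pose lone x := {in D &, forall e1 e2, x \in e1 -> x \in e2 -> e1 = e2}.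
have loneN x e : e \in D -> ~ lone x -> x \in e -> exists2 e', e' \in D & x \in e' /\ e' != e.
  move=> De xN xe; have [/exists_inP[e' De' /andP[]]|H] :=
    boolP [exists e' in D, (x \in e') && (e' != e)]; first by exists e'.
  exfalso; apply: xN => e1 e2 De1 De2 xe1 xe2.
  have all_e e' : e' \in D -> x \in e' -> e' = e.
    move=> De' xe'; apply/eqP; apply: contraNT H => ne'.
    by apply/exists_inP; exists e'; rewrite ?xe'.
  by rewrite (all_e _ De1 xe1) (all_e _ De2 xe2).
have loneVN x : lone x \/ ~ lone x.
  have [/forall_inP H|H] := boolP [forall e1 in D, [forall e2 in D,
      (x \in e1) ==> (x \in e2) ==> (e1 == e2)]].
    left=> e1 e2 De1 De2 xe1 xe2.
    by have /forall_inP/(_ e2 De2) := H e1 De1; rewrite xe1 xe2 => /eqP.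
  right=> xl; case/negP: H; apply/forall_inP=> e1 De1; apply/forall_inP=> e2 De2.
  by apply/implyP=> xe1; apply/implyP=> xe2; apply/eqP; apply: xl.
have /fin_all_exists[f fP] (e : {set G}) : exists p : G * G,
    e \in D -> [/\ e = [set p.1; p.2], adj p.1 p.2 & lone p.1].
  have [De|_] := boolP (e \in D); last by exists (x0, x0).
  have /edgesP[x [y [xy def_e]]] := subsetP DE e De.
  have [xl|xN] := loneVN x; first by exists (x, y).
  have [yl|yN] := loneVN y; first by exists (y, x); rewrite setUC adj_sym.
  have [xe ye] : x \in e /\ y \in e by rewrite def_e set21 set22.
  (* Neither end is lone, so other edges [e1] at [x] and [e2] at [y] exist. If they coincide they
     equal [e]; otherwise [e] is a common edge of them. *)
  have [e1 De1 [xe1 /negP ne1]] := loneN x e De xN xe.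
  have [e2 De2 [ye2 /negP ne2]] := loneN y e De yN ye.
  have [E|ne12] := eqVneq e1 e2.
    case: ne1; apply/eqP; rewrite def_e.
    apply: edge_eq_set2; rewrite ?(subsetP DE) // E // in xe1 *.
    by apply: contraTneq xy => ->; rewrite adj_irr.
  by have [E|E] := Deop _ _ _ _ De1 De2 ne12 xe1 ye2 xy;
    [case: ne1|case: ne2]; rewrite def_e E.
exists (fun e => (f e).1), (fun e => (f e).2).
have le e : e \in D -> (f e).1 \in e by case/fP=> E _ _; have := set21 (f e).1 (f e).2; rewrite -E.
have ce e : e \in D -> (f e).2 \in e by case/fP=> E _ _; have := set22 (f e).1 (f e).2; rewrite -E.
have lN e e' : e \in D -> e' \in D -> (f e).1 \in e' -> e = e'.
  by move=> De De' le'; have [_ _ el] := fP e De; apply: el => //; apply: le.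
have inD e x : e \in D -> x \in e -> x = (f e).1 \/ x = (f e).2.
  by case/fP=> E _ _; rewrite E => /set2P; rewrite -E.
split=> [e De|e e' De De'|e e' De De' /= E]; first by have [] := fP e De.
  have [->|ne] := eqVneq e e'; first by have [_ -> _] := fP e' De'; rewrite !adj_irr eqxx.
  (* An adjacency between two edges of [D] forces a shared vertex; a lone vertex is not shared, so
     only a shared centre remains. *)
  have lc x y : x \in e -> y \in e' -> adj x y -> y \in e \/ x \in e'.
    by move=> xe ye xy; have [<-|<-] := Deop _ _ _ _ De De' ne xe ye xy;
      [left; rewrite set22|right; rewrite set21].
  split.
  - apply/idP/eqP=> [a|<-]; last by have [] := fP e De.
    have [c'e|/lN E] := lc _ _ (le e De) (ce e' De') a; last by rewrite E ?eqxx in ne.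
    case: (inD _ _ De c'e) => // c'l.
    by move: (ce e' De'); rewrite c'l => /lN E; rewrite E ?eqxx in ne.
  - apply/negP=> /(lc _ _ (le e De) (le e' De'))[] /lN E; last by rewrite E ?eqxx in ne.
    by rewrite -E ?eqxx in ne.
  apply/negP=> a; have [c'e|ce'] := lc _ _ (ce e De) (ce e' De') a.
    case: (inD _ _ De c'e) => c'l; last by rewrite c'l adj_irr in a.
    by move: (ce e' De'); rewrite c'l => /lN E; rewrite E ?eqxx in ne.
  case: (inD _ _ De' ce') => c'l; last by rewrite c'l adj_irr in a.
  by move: (ce e De); rewrite c'l => /lN E; rewrite -E ?eqxx in ne.
by apply: lN => //; rewrite E le.
Qed.

Lemma eop_setU1 D (z u : G) : eop D -> z \notin cover D -> adj z u ->
  {in cover D, forall v, adj z v -> v = u} ->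
  {in D, forall e x, x \in e -> adj u x -> u \in e} ->
  eop ([set z; u] |: D).
Proof.
move=> Deop' zD zu zN uN; have /eopP[DE Deop] := Deop'.
have new e x y : e \in D -> x \in [set z; u] -> y \in e -> adj x y ->
    [set x; y] = [set z; u] \/ [set x; y] = e.
  move=> De xzu ye xy; have Dy : y \in cover D by apply/bigcupP; exists e.
  move: xzu; rewrite !inE => /orP[]/eqP E; rewrite E in xy *.
    by left; rewrite (zN y).
  right; apply/esym/edge_eq_set2 => //; first exact: (subsetP DE).
    by apply: uN xy.
  by apply: contraTneq xy => ->; rewrite adj_irr.
apply/eopP; split; first by rewrite subUset sub1set edge_set2.
move=> e1 e2 x y /setU1P[->|De1] /setU1P[->|De2]; first by rewrite eqxx.
- by move=> _ xe1 ye2; apply: new.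
- by move=> _ xe1 ye2; rewrite adj_sym setUC => /(new _ _ _ De1 ye2 xe1)[]; [right|left].
exact: Deop.
Qed.

Lemma eop_number_geq D n : eop D -> n <= #|D| -> n <= eop_number G.
Proof. by move=> Deop le_n; apply: leq_trans le_n _; apply: leq_bigmax_cond. Qed.

End StarSystems.

(** * Induced stars *)

Section Stars.
Variable G : sgraph.
Implicit Types (u x y : G) (L : {set G}).

Lemma isomorphic_sym (H K : sgraph) : isomorphic H K -> isomorphic K H.
Proof.
case=> f [[g fK gK] fadj]; exists g; split; first by exists f.
by move=> x y; rewrite -fadj !gK.
Qed.

Lemma induced_star u L : {in L, forall x, adj u x} -> {in L &, forall x y, ~~ adj x y} ->
  star_centre (u |: L) #|L| u.
Proof.
move=> uL LL; have uNL : u \notin L by apply/negP=> /uL; rewrite adj_irr.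
pose f (o : star #|L|) : induced (u |: L) :=
  if o is Some i then exist _ (enum_val i) (setU1r u (enum_valP i)) else exist _ u (setU11 u L).
have valf o : val (f o) = if o is Some i then enum_val i else u by case: o.
exists f; last by [].
split=> [|[i|] [j|]]; last 1 first.
- exact: adj_irr.
- apply: inj_card_bij.
    move=> o o' /(congr1 val); rewrite !valf; case: o o' => [i|] [j|] //.
    + by move/enum_val_inj->.
    + by move=> E; case/negP: uNL; rewrite -E enum_valP.
    by move=> E; case/negP: uNL; rewrite E enum_valP.
  by rewrite card_sig card_option card_ord cardsU1 uNL.
- by apply/negP/negP/LL; apply: enum_valP.
- by apply/idP; rewrite /= /induced_adj /= adj_sym; apply: uL; apply: enum_valP.
by apply/idP; rewrite /= /induced_adj /=; apply: uL; apply: enum_valP.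
Qed.

Lemma star_centre_isomorphic (A : {set G}) r u :
  star_centre A r u -> isomorphic (induced A) (star r).
Proof. by case=> f fP _; apply: isomorphic_sym; exists f. Qed.

(** The edges of the induced star form a star system whose centre map is constant. *)
Lemma has_induced_star_leq r : has_induced G (star r) -> r <= eop_number G.
Proof.
case=> A /isomorphic_sym[f [/bij_inj f_inj fadj]].
pose l (i : 'I_r) := val (f (Some i)); pose c (i : 'I_r) := val (f None).
have adjE (o o' : star r) : adj (val (f o)) (val (f o')) = isSome o (+) isSome o'.
  exact: fadj.
rewrite -[leqLHS]card_ord -cardsT; apply: (@star_system_leq _ _ _ l c).
  by move=> i j _ _; rewrite /l /c !adjE eqxx.
by move=> i j _ _ /val_inj/f_inj[].
Qed.

End Stars.

(** * EOP sets along shortest paths *)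

Section Diameter.
Variable G : sgraph.
Hypothesis Gc : connected_graph G.

Lemma diam_leqP n : reflect (forall x y : G, dist x y <= n) (diam G <= n).
Proof.
rewrite /diam; apply: (iffP (bigmax_leqP _ _ _)) => [H x y|H x _].
  by have /bigmax_leqP := H x isT; apply.
by apply/bigmax_leqP.
Qed.

Lemma dist_le1 (x y : G) : dist x y <= 1 -> x = y \/ adj x y.
Proof.
have [p [xp yp <-]] := dist_walk x y Gc.
case: p xp yp => [|z [|//]] /=; first by left.
by rewrite andbT => xz <-; right.
Qed.

(* The edges number 4k and 4k+1 of a shortest path form an EOP set; they have
   centre [p (4k+1)] and the leaves are the vertices [p (2k)]. *)
Lemma geodesic_leq (x y : G) n :
  2 * n + ~~ odd n <= dist x y -> n < eop_number G.
Proof.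
have [p [_ pd pa]] := geodesic x y Gc => le_n.
(* Adjacent vertices of a shortest path are consecutive, because their distances from [x] differ by
   at most one. *)
have pi i j : i <= dist x y -> j <= dist x y -> adj (p i) (p j) -> i = j.+1 \/ j = i.+1.
  move=> le_i le_j a; have ne : i != j by apply: contraTneq a => ->; rewrite adj_irr.
  have := dist_adj x Gc a; rewrite adj_sym in a.
  by have := dist_adj x Gc a; rewrite !pd //; lia.
pose l (i : 'I_n.+1) := p (2 * i).
(* The centre follows the leaf for even [i] and precedes it for odd [i]. The last index used is thus
   [2 * n] for odd [n] and [2 * n + 1] for even [n], which explains the bound. *)
pose ci i := if odd i then (2 * i).-1 else (2 * i).+1.
have le_l (i : 'I_n.+1) : 2 * i <= dist x y by case: i => i /=; lia.
have le_c (i : 'I_n.+1) : ci i <= dist x y.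
  by rewrite /ci; case: i => i lt_i; case: ifP => /= oi; have [E|ne] := eqVneq i n; subst; lia.
have p_inj i j : i <= dist x y -> j <= dist x y -> p i = p j -> i = j.
  by move=> le_i le_j E; rewrite -(pd i) // -(pd j) // E.
rewrite -[n.+1]card_ord -cardsT.
apply: (@star_system_leq _ _ _ l (fun i => p (ci i))) => [i j _ _|i j _ _ E].
  have li := le_l i; have lj := le_l j; have ki := le_c i; have kj := le_c j.
  split.
  - apply/idP/eqP=> [/(pi _ _ li kj) H|<-].
      congr (p _); move: H; rewrite /ci.
      by case: ifP; case: ifP; lia.
    rewrite /l /ci; case: ifP ki => oi; rewrite /ci oi => ki; last by apply: pa.
    have -> : 2 * i = (2 * i).-1.+1 by lia.
    by rewrite adj_sym; apply: pa; lia.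
  - by apply/negP=> /(pi _ _ li lj); lia.
  by apply/negP=> /(pi _ _ ki kj); rewrite /ci; case: ifP; case: ifP; lia.
by apply/val_inj => /=; have := p_inj _ _ (le_l i) (le_l j) E; lia.
Qed.
End Diameter.

(** * Necessity of the four conditions *)

Section Necessity.
Variable G : sgraph.
Hypothesis Gc : connected_graph G.
Implicit Types (D M : {set {set G}}) (x y z : G).

(** In a complete graph two distinct edges always have a common edge: join an end of each that is
    not on the other. *)
Lemma diam_gt1 : 1 < eop_number G -> 1 < diam G.
Proof.
move=> eop2; rewrite ltnNge; apply/negP=> /diam_leqP le1.
have: eop_number G <= 1; last by rewrite leqNgt eop2.
apply/bigmax_leqP=> D /eopP[DE Deop]; rewrite leqNgt; apply/negP=> /card_gt1P[e1 [e2]].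
case=> De1 De2 ne12.
have pick_diff e e' : e \in D -> e' \in D -> e != e' -> exists2 x, x \in e & x \notin e'.
  move=> De De' ne; apply/subsetPn; apply: contra ne => sub.
  by rewrite eqEcard sub !card_edge ?(subsetP DE).
have [x xe1 xNe2] := pick_diff _ _ De1 De2 ne12.
have [y ye2 yNe1] : exists2 y, y \in e2 & y \notin e1 by apply: pick_diff; rewrite // eq_sym.
have [xy|xy] := dist_le1 Gc (le1 x y); first by rewrite xy ye2 in xNe2.
have [E|E] := Deop _ _ _ _ De1 De2 ne12 xe1 ye2 xy.
  by rewrite -E set22 in yNe1.
by rewrite -E set21 in xNe2.
Qed.

(** A shortest path with [2 * t + 1] edges would carry [t + 1] edges of an EOP set. *)
Lemma diam_leq t : eop_number G <= t -> diam G <= 2 * t.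
Proof.
move=> le_t; apply/diam_leqP => x y; rewrite leqNgt; apply/negP=> lt_d.
have := @geodesic_leq G Gc x y t; rewrite ltnNge le_t => /(_ _)/notF; apply.
by case: odd; lia.
Qed.

Lemma induced_matchingP M :
  reflect (M \subset edges G /\
    {in M &, forall e1 e2 : {set G}, e1 != e2 -> forall x y, x \in e1 -> y \in e2 -> x != y /\ ~~ adj x y})
    (induced_matching M).
Proof.
apply: (iffP andP) => [[/andP[ME /trivIsetP Mtriv] Mind]|[ME Mind]]; split=> //.
- move=> e1 e2 Me1 Me2 ne12 x y xe1 ye2.
  have /forall_inP/(_ e2 Me2)/implyP/(_ ne12) := forall_inP Mind e1 Me1.
  move=> /forall_inP/(_ x xe1)/forall_inP/(_ y ye2) ->; split=> //.
  apply: contraTneq ye2 => <-; have := Mtriv _ _ Me1 Me2 ne12.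
  by move/disjointFr->.
- rewrite /matching ME; apply/trivIsetP=> e1 e2 Me1 Me2 ne12.
  apply/pred0P=> x /=; apply/andP=> -[xe1 xe2].
  by have [/eqP] := Mind _ _ Me1 Me2 ne12 _ _ xe1 xe2.
apply/forall_inP=> e1 Me1; apply/forall_inP=> e2 Me2; apply/implyP=> ne12.
apply/forall_inP=> x xe1; apply/forall_inP=> y ye2.
by have [] := Mind _ _ Me1 Me2 ne12 _ _ xe1 ye2.
Qed.

Lemma induced_matching_eop M : induced_matching M -> eop M.
Proof.
case/induced_matchingP=> ME Mind; apply/eopP; split=> // e1 e2 x y Me1 Me2 ne12 xe1 ye2.
by have [_ /negPf->] := Mind _ _ Me1 Me2 ne12 _ _ xe1 ye2.
Qed.

(** * Neighbours of a vertex outside an induced matching *)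

Section Matching.
Variable M : {set {set G}}.
Hypothesis Mind : induced_matching M.

Let dis e1 e2 x : e1 \in M -> e2 \in M -> x \in e1 -> x \in e2 -> e1 = e2.
Proof.
have /induced_matchingP[_ H] := Mind => Me1 Me2 xe1 xe2; apply/eqP/idPn=> ne12.
by have [/eqP] := H _ _ Me1 Me2 ne12 _ _ xe1 xe2.
Qed.

Let nadj e1 e2 x y : e1 \in M -> e2 \in M -> e1 != e2 -> x \in e1 -> y \in e2 -> adj x y = false.
Proof.
have /induced_matchingP[_ H] := Mind => Me1 Me2 ne12 xe1 ye2.
by have [_ /negPf] := H _ _ Me1 Me2 ne12 _ _ xe1 ye2.
Qed.

(* Recentre at [y] the edges of [M] that have an end vertex adjacent to [y],
   and add the edge from [y] to [w]. *)
Lemma induced_matching_far_leq y w : y \notin cover M -> w \notin cover M -> adj w y ->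
  {in cover M, forall v, ~~ adj w v} -> #|M| < eop_number G.
Proof.
move=> yM wM wy wN.
have in_cover e x : e \in M -> x \in e -> x \in cover M by move=> Me xe; apply/bigcupP; exists e.
(* [f e] is the pair of leaf and centre of the new edge: an end adjacent to [y] with [y] itself, or
   else [e] in either orientation. Off [M] the value is a dummy. *)
have /fin_all_exists[f fP] (e : {set G}) : exists p : G * G, e \in M ->
    [/\ p.1 \in e, adj p.1 p.2 &
        p.2 = y \/ p.2 \in e /\ {in e, forall x, ~~ adj x y}].
  have [Me|_] := boolP (e \in M); last by exists (y, y).
  have [/exists_inP[x xe xy]|/exists_inPn H] := boolP [exists x in e, adj x y].
    by exists (x, y) => _; split=> //; left.
  have /induced_matchingP[ME _] := Mind.
  have /edgesP[a [b [ab E]]] := subsetP ME e Me.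
  by exists (a, b) => _; split=> //=; [|right; split=> //]; rewrite E ?set21 ?set22.
(* [None] indexes the additional edge, with leaf [w] and centre [y]. *)
pose g o := if o is Some e then f e else (w, y).
pose A := None |: [set Some e | e in M].
have AP o : o \in A -> if o is Some e then e \in M else true.
  by case/setU1P=> [->|/imsetP[e Me ->]].
have <- : #|A| = #|M|.+1.
  by rewrite cardsU1 card_imset ?inj_SomeP //; [case: imsetP => // -[]|move=> ? ? []].
have ceq e : e \in M -> (f e).2 <> y -> (f e).2 \in e /\ {in e, forall x, ~~ adj x y}.
  by case/fP=> _ _ [].
(* Recentred edges share the centre [y]. A kept edge has no end adjacent to [y], and its centre
   differs from [y] because [y] is not on [M]. *)
apply: (@star_system_leq _ _ _ (fun o => (g o).1) (fun o => (g o).2)).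
  move=> [e|] [e'|] /AP Me /AP Me' /=; last by rewrite wy !adj_irr eqxx.
  - have [<-|ne] := eqVneq e e'; first by have [_ -> _] := fP e Me; rewrite !adj_irr eqxx.
    have [le lc ce] := fP e Me; have [le' lc' ce'] := fP e' Me'.
    rewrite (nadj Me Me' ne le le'); split=> //.
      case: ce ce' => [E|[ce eN]] [E'|[ce' eN']].
      - by rewrite E' -E lc eqxx.
      - rewrite (nadj Me Me' ne le ce') E; apply/esym/eqP=> yE.
        by rewrite yE (in_cover _ _ Me' ce') in yM.
      - rewrite E' (negPf (eN _ le)); apply/esym/eqP=> yE.
        by rewrite -yE (in_cover _ _ Me ce) in yM.
      rewrite (nadj Me Me' ne le ce'); apply/esym/eqP=> E.
      by rewrite E in ce; rewrite (dis Me Me' ce ce') eqxx in ne.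
    case: ce ce' => [E|[ce eN]] [E'|[ce' eN']].
    - by rewrite E E' adj_irr.
    - by rewrite E adj_sym eN'.
    - by rewrite E' eN.
    by rewrite (nadj Me Me' ne ce ce').
  - have [le lc [E|[ce eN]]] := fP e Me; rewrite adj_sym; last first.
      rewrite adj_sym (negPf (eN _ le)) eN //; split=> //.
        apply/esym/eqP=> yE; by rewrite -yE (in_cover _ _ Me ce) in yM.
      by rewrite adj_sym wN // (in_cover _ _ Me).
    rewrite E adj_irr eqxx adj_sym -{1}E lc; split=> //.
    by rewrite adj_sym wN // (in_cover _ _ Me).
  have [le lc [E|[ce eN]]] := fP e' Me'; rewrite (wN _ (in_cover _ _ Me' le)).
    by rewrite E wy eqxx adj_irr.
  rewrite (negPf (wN _ (in_cover _ _ Me' ce))) (adj_sym y) eN //; split=> //.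
  by apply/esym/eqP=> yE; rewrite yE (in_cover _ _ Me' ce) in yM.
move=> [e|] [e'|] /AP Me /AP Me' //= E.
- have [le _ _] := fP e Me; have [le' _ _] := fP e' Me'; rewrite E in le.
  by rewrite (dis Me Me' le le').
- by have [le _ _] := fP e Me; rewrite -E (in_cover _ _ Me) in wM.
by have [le _ _] := fP e' Me'; rewrite E (in_cover _ _ Me') in wM.
Qed.

Lemma induced_matching_dominating z : 0 < #|M| -> eop_number G <= #|M| ->
  z \notin cover M -> exists2 v, v \in cover M & adj z v.
Proof.
move=> M_gt0 le_M zM.
(* [X] is the closed neighbourhood of [cover M]. An edge leaving it would enlarge the EOP set by the
   preceding construction, so by connectedness [X] is everything. *)
pose X := [set v | (v \in cover M) || [exists x in cover M, adj v x]].
have Xclosed : closed (@adj G) (mem X).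
  apply: intro_closed => [|x y xy]; first exact/sym_connect_sym/adj_sym.
  rewrite !inE => xX; have [//|yM /=] := boolP (y \in cover M).
  apply: contraLR le_M => yN; rewrite -ltnNge.
  have xM : x \notin cover M.
    by apply: contra yN => xM; apply/exists_inP; exists x; rewrite // adj_sym.
  apply: (@induced_matching_far_leq x y) => //; first by rewrite adj_sym.
  by move=> v vM; apply: contra yN => yv; apply/exists_inP; exists v.
have [e Me] := card_gt0P M_gt0; have /induced_matchingP[ME _] := Mind.
have /edgesP[a [b [ab E]]] := subsetP ME e Me.
have aX : a \in X by rewrite inE; apply/orP; left; apply/bigcupP; exists e; rewrite // E set21.
have := closed_connect Xclosed (Gc.2 a z); rewrite /= aX => /esym.
by rewrite inE (negPf zM) => /exists_inP.
Qed.

(** A neighbour [v] on [M] exists by domination; were it the only one, adding the edge from [z] to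
    [v] would give a larger EOP set. *)
Lemma induced_matching_two_neighbours z : 0 < #|M| -> eop_number G <= #|M| ->
  z \notin cover M -> 2 <= #|[set v in cover M | adj z v]|.
Proof.
move=> M_gt0 le_M zM; have [v vM zv] := induced_matching_dominating M_gt0 le_M zM.
rewrite ltnNge; apply/negP=> /card_le1_eqP one; move: le_M; apply/negP; rewrite -ltnNge.
have: eop ([set z; v] |: M).
  apply: eop_setU1 => //; first exact: induced_matching_eop.
    by move=> x xM zx; apply: one; rewrite inE ?xM ?vM.
  move=> e Me x xe vx; have /bigcupP[e' Me' ve'] := vM.
  have [<- //|ne] := eqVneq e' e.
  by rewrite (nadj Me' Me ne ve' xe) in vx.
move/eop_number_geq; apply; rewrite cardsU1.
suff -> : [set z; v] \notin M by rewrite add1n.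
by apply: contra zM => zvM; apply/bigcupP; exists [set z; v]; rewrite ?set21.
Qed.
End Matching.

(** * Extending an EOP set at the centre of a star component *)

Lemma component_closed (A C : {set G}) x y : C \in components A ->
  x \in C -> y \in A -> adj x y -> y \in C.
Proof.
case/imsetP=> a Aa ->; rewrite !inE => /andP[Ax ax] Ay xy; rewrite Ay.
by apply: connect_trans ax (connect1 _); rewrite /= Ax Ay.
Qed.

Lemma star_centre_extension D (C : {set G}) r z u : eop D -> C \in components (cover D) ->
  star_centre C r u -> eop_number G <= #|D| -> z \notin cover D -> adj z u ->
  exists2 v, v \in cover D :\ u & adj z v.
Proof.
move=> Deop CD [f [[g fK gK] fadj] fu] le_D zD zu.
have [/exists_inP//|/exists_inPn zN] := boolP [exists v in cover D :\ u, adj z v].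
have Csub x : x \in C -> x \in cover D by case/imsetP: CD => a _ ->; rewrite inE => /andP[].
have uC : u \in C by rewrite -fu; apply: valP.
move: le_D; rewrite leqNgt => /negP[].
have: eop ([set z; u] |: D).
  apply: eop_setU1 => //.
    by move=> v vD zv; apply/eqP/idPn=> ne; have := zN v; rewrite !inE ne vD zv => /(_ isT).
  move=> e De x xe ux; have /eopP[DE _] := Deop.
  have sub_e y : y \in e -> y \in cover D by move=> ye; apply/bigcupP; exists e.
  have xC := component_closed CD uC (sub_e _ xe) ux.
  have [y ye xy] : exists2 y, y \in e & adj x y.
    have /edgesP[a [b [ab E]]] := subsetP DE e De; move: xe; rewrite E => /set2P[]->.
      by exists b; rewrite ?set22.
    by exists a; rewrite ?set21 // adj_sym.
  have yC := component_closed CD xC (sub_e _ ye) xy.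
  have := fadj (g (exist _ x xC)) (g (exist _ y yC)).
  have := fadj None (g (exist _ x xC)).
  rewrite !gK /= /induced_adj /= fu ux xy /star_adj; case gx: (g _) => [i|] // _.
  by case gy: (g _) => [j|] // _; rewrite -fu -gy gK.
move/eop_number_geq; apply; rewrite cardsU1.
suff -> : [set z; u] \notin D by rewrite add1n.
by apply: contra zD => zvM; apply/bigcupP; exists [set z; u]; rewrite ?set21.
Qed.

End Necessity.

(** * Components of a star system *)

Section Sufficiency.
Variables (G : sgraph) (D : {set {set G}}) (l c : {set G} -> G).
Hypotheses (Deop : eop D) (lcD : star_system D l c).
Hypotheses (lcE : {in D, forall e, e = [set l e; c e]}) (l_inj : {in D &, injective l}).

Definition star_block (A : {set {set G}}) u := u |: l @: [set e in A | c e == u].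

Lemma star_system_coverP (A : {set {set G}}) v : A \subset D ->
  reflect (exists2 e, e \in A & v = l e \/ v = c e) (v \in cover A).
Proof.
move=> /subsetP sAD; apply: (iffP bigcupP) => -[e Ae ve]; exists e => //.
  by apply/set2P; rewrite -lcE // sAD.
by rewrite (lcE (sAD _ Ae)); apply/set2P.
Qed.

(** With distinct centres each star is a single edge, and no edges run between different stars. *)
Lemma star_system_induced_matching (A : {set {set G}}) : A \subset D ->
  {in A &, injective c} -> induced_matching A.
Proof.
move=> sAD c_inj; have sAD' := subsetP sAD; apply/induced_matchingP.
split; first by apply: subset_trans sAD _; case/eopP: Deop.
move=> e1 e2 Ae1 Ae2 ne x y; have [De1 De2] := (sAD' _ Ae1, sAD' _ Ae2).
have neq_c : c e1 != c e2 by apply: contra ne => /eqP/c_inj->.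
have neq_l : l e1 != l e2 by apply: contra ne => /eqP/l_inj->.
have [lc ll cc] := lcD De1 De2; have [lc' _ _] := lcD De2 De1.
rewrite (lcE De1) (lcE De2) => /set2P[]-> /set2P[]->; split=> //.
- exact: (star_system_leaf_neq_centre lcD).
- by rewrite lc.
- by rewrite eq_sym (star_system_leaf_neq_centre lcD).
by rewrite adj_sym lc' eq_sym.
Qed.

Lemma star_system_star_centre (A : {set {set G}}) u : A \subset D ->
  star_centre (star_block A u) #|[set e in A | c e == u]| u.
Proof.
move=> /subsetP sAD.
have <- : #|l @: [set e in A | c e == u]| = #|[set e in A | c e == u]|.
  apply: card_in_imset => e e'; rewrite !inE => /andP[/sAD De _] /andP[/sAD De' _].
  exact: l_inj.
apply: induced_star => [x /imsetP[e + ->]|x y /imsetP[e + ->] /imsetP[e' + ->]].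
  by rewrite inE => /andP[/sAD De /eqP<-]; rewrite adj_sym (star_system_adj lcD).
rewrite !inE => /andP[/sAD De _] /andP[/sAD De' _].
by have [_] := lcD De De'.
Qed.

(** Each block is connected through its centre, and no adjacency within [cover A] leaves it, since
    adjacent leaf and centre belong to the same star. *)
Lemma star_system_components (A : {set {set G}}) : A \subset D ->
  components (cover A) = star_block A @: (c @: A).
Proof.
move=> sAD; have sAD' := subsetP sAD.
set R := [rel x y | [&& x \in cover A, y \in cover A & adj x y]].
have Rsym : connect_sym R.
  by apply: sym_connect_sym => x y /=; rewrite adj_sym andbCA.
have cA e : e \in A -> c e \in cover A by move=> Ae; apply/star_system_coverP => //; exists e; auto.
have lA e : e \in A -> l e \in cover A by move=> Ae; apply/star_system_coverP => //; exists e; auto.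
have block x e : e \in A -> x = l e \/ x = c e ->
    [set y in cover A | connect R x y] = star_block A (c e).
  move=> Ae xe; have De := sAD' _ Ae.
  have lc e' : e' \in A -> connect R (l e') (c e').
    by move=> Ae'; apply: connect1; rewrite /= lA ?cA ?(star_system_adj lcD) ?sAD'.
  have xc : connect R x (c e) by case: xe => ->; [apply: lc|apply: connect0].
  have xS : x \in star_block A (c e).
    by case: xe => ->; rewrite ?setU11 // setU1r // imset_f // inE Ae eqxx.
  have Sclosed : closed R (mem (star_block A (c e))).
    apply: intro_closed => // y y' /and3P[_ /(star_system_coverP _ sAD)[e' Ae' ye'] yy'] yS.
    have De' := sAD' _ Ae'; have [a1 a2 a3] := lcD De De'; have [a4 _ _] := lcD De' De.
    have in_star : c e' = c e -> y' \in star_block A (c e).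
      by move=> E; case: ye' => ->; rewrite ?E ?setU11 // setU1r // imset_f // inE Ae' E eqxx.
    apply: in_star; case/setU1P: yS => [yE|/imsetP[e'']].
      rewrite yE in yy'; case: ye' => y'E; rewrite y'E in yy'; last by rewrite yy' in a3.
      by apply/eqP; rewrite -a4 adj_sym.
    rewrite inE => /andP[Ae'' /eqP<-] yE; rewrite yE in yy'.
    have [b1 b2 b3] := lcD (sAD' _ Ae'') De'.
    case: ye' => y'E; rewrite y'E in yy'; first by rewrite yy' in b2.
    by apply/esym/eqP; rewrite -b1.
  apply/setP=> y; rewrite inE; apply/andP/idP => [[yA xy]|].
    by have := closed_connect Sclosed xy; rewrite /= xS => <-.
  case/setU1P=> [->|/imsetP[e']]; first by rewrite cA.
  rewrite inE => /andP[Ae' /eqP E] ->; rewrite lA //; split=> //.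
  by apply: connect_trans xc _; rewrite -E Rsym lc.
apply/setP=> C; apply/imsetP/imsetP=> [[x /(star_system_coverP _ sAD)[e Ae xe] ->]|].
  by exists (c e); [apply: imset_f|apply: block].
by case=> _ /imsetP[e Ae ->] ->; exists (c e); [apply: cA|apply/esym/block; auto].
Qed.

(** A centre lying in the block of another centre would be a leaf. *)
Lemma star_block_inj (A : {set {set G}}) : A \subset D -> {in c @: A &, injective (star_block A)}.
Proof.
move=> /subsetP sAD u v /imsetP[e Ae ->] /imsetP[e' Ae' ->] E.
have: c e \in star_block A (c e') by rewrite -E setU11.
case/setU1P=> // /imsetP[e'']; rewrite inE => /andP[Ae'' _] /esym/eqP.
by rewrite (negPf (star_system_leaf_neq_centre lcD _ _)) ?sAD.
Qed.

End Sufficiency.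

(** * The upper bound from (C2), (C3) and (C4) *)

(** Needed since (C4) lists the star sizes in nondecreasing order: the centres are sorted by the
    size of their star. *)
Lemma sorted_tuple_enumeration (T : finType) (P : {set T}) (r : T -> nat) :
  exists s : #|P|.-tuple T,
    [/\ injective (tnth s), forall x, (x \in s) = (x \in P),
       sorted leq (map_tuple r s) & \sum_(i < #|P|) tnth (map_tuple r s) i = \sum_(x in P) r x].
Proof.
pose us := sort (relpre r leq) (enum P).
have us_size : size us == #|P| by rewrite size_sort cardE.
exists (Tuple us_size); split.
- by apply/tuple_uniqP; rewrite sort_uniq enum_uniq.
- by move=> x; rewrite mem_sort mem_enum.
- by rewrite /= sorted_map sort_sorted // => x y; apply: leq_total.
rewrite (eq_bigr (fun i => r (tnth (Tuple us_size) i))); last by move=> i _; rewrite tnth_map.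
by rewrite -(big_tuple _ _ _ xpredT r) (perm_big (enum P)) ?big_enum // perm_sort.
Qed.

Lemma eop_upper_bound (G : sgraph) t : connected_graph G -> 2 <= t ->
  (forall s : nat, t + 1 <= s -> ~ has_induced G (star s)) ->
  (forall M : {set {set G}}, induced_matching M -> #|M| = t ->
     forall z : G, z \notin cover M -> 2 <= #|[set v in cover M | adj z v]|) ->
  (3 <= t ->
     forall s : nat, 2 <= s <= t - 1 ->
     forall r : s.-tuple nat,
       (forall i : 'I_s, 1 <= tnth r i) -> sorted leq r ->
       \sum_(i < s) tnth r i = t ->
     forall D : {set {set G}}, eop D -> #|D| = t ->
     forall C : 'I_s -> {set G},
       injective C -> [set C i | i : 'I_s] = components (cover D) ->
       (forall i : 'I_s, isomorphic (induced (C i)) (star (tnth r i))) ->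
     forall z : G, z \notin cover D ->
     forall (j : 'I_s) (u : G),
       star_centre (C j) (tnth r j) u -> adj z u ->
       exists2 v : G, v \in cover D :\ u & adj z v) ->
  eop_number G <= t.
Proof.
move=> Gc t2 noStar twoNbrs C4; rewrite leqNgt; apply/negP=> lt_t.
(* Subsets of EOP sets are EOP, so the size can be taken to be exactly [t + 1]. *)
have [D Deop Dcard] : exists2 D : {set {set G}}, eop D & #|D| = t.+1.
  have [D0 D0eop] : exists2 D0 : {set {set G}}, eop D0 & t < #|D0|.
    apply/exists_inP; apply: contraLR lt_t => /exists_inPn H; rewrite -leqNgt.
    by apply/bigmax_leqP=> D /H; rewrite -leqNgt.
  case/card_geqP=> s [us ss sD]; exists [set e in s].
    by apply: eop_subset D0eop; apply/subsetP=> e; rewrite inE => /sD.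
  by rewrite cardsE (card_uniqP us).
have /card_gt0P[x0 _] := Gc.1.
have [l [c [lcE lcD l_inj]]] := eop_star_system x0 Deop.
have card_D1 e0 : e0 \in D -> #|D :\ e0| = t.
  by move=> De0; have := cardsD1 e0 D; rewrite De0 Dcard add1n => -[].
have sD e0 : D :\ e0 \subset D by apply: subsetDl.
have coverP e0 v := star_system_coverP lcE v (sD e0).
have lN e0 : e0 \in D -> l e0 \notin cover (D :\ e0).
  move=> De0; apply/negP=> /coverP[e /setD1P[ne De]] [E|/eqP].
    by rewrite (l_inj _ _ De0 De E) eqxx in ne.
  by apply/negP; apply: (star_system_leaf_neq_centre lcD).
have nbr e0 v : e0 \in D -> v \in cover (D :\ e0) -> adj (l e0) v -> v = c e0.
  move=> De0 /coverP[e /setD1P[ne De] ve] a; have [lc ll _] := lcD _ _ De0 De.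
  case: ve => E; rewrite E in a *; first by rewrite a in ll.
  by apply/esym/eqP; rewrite -lc.
(* Otherwise the remaining edges form an induced matching of size [t], on which [l e0] has at most
   the neighbour [c e0], against (C3). *)
have c_ninj e0 : e0 \in D -> ~ {in D :\ e0 &, injective c}.
  move=> De0 c_inj.
  have := twoNbrs _ (star_system_induced_matching Deop lcD lcE l_inj (sD e0) c_inj)
    (card_D1 _ De0) _ (lN _ De0).
  apply/negP; rewrite -leqNgt; apply/card_le1_eqP=> u v; rewrite !inE.
  by case/andP=> uC ua /andP[vC va]; rewrite (nbr _ _ De0 uC ua) (nbr _ _ De0 vC va).
have [e0 De0 [e1 De1 [ne c01]]] : exists2 e0, e0 \in D &
    exists2 e1, e1 \in D & e0 != e1 /\ c e0 = c e1.
  have [e De] : exists e, e \in D by apply/card_gt0P; rewrite Dcard.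
  have /dinjectivePn[e0 /setD1P[_ De0] [e1]] : ~~ dinjectiveb c (D :\ e).
    by apply/dinjectiveP/c_ninj.
  by rewrite !inE => /and3P[ne _ De1] c01; exists e0 => //; exists e1; rewrite // eq_sym.
(* If all centres agreed, [D] would be an induced star with [t + 1] leaves, against (C2). *)
have [e2 De2 c02] : exists2 e2, e2 \in D & c e2 != c e0.
  apply/exists_inP; apply: contraT => /exists_inPn H.
  have c_const e : e \in D -> c e = c e0 by move=> /H; rewrite negbK => /eqP.
  case: (noStar t.+1); rewrite ?addn1 //.
  have := star_system_star_centre lcD l_inj (c e0) (subxx D).
  have -> : [set e in D | c e == c e0] = D.
    by apply/setP=> e; rewrite inE andb_idr // => /c_const->.
  by rewrite Dcard => /star_centre_isomorphic; exists (star_block l c D (c e0)).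
(* (C4) is applied to [M] with the vertex [l e0]. The star of [e0] survives in [M] through [e1], so
   [c e0] is still the centre of a component. *)
pose M := D :\ e0; pose P := c @: M; pose r u := #|[set e in M | c e == u]|.
have Me1 : e1 \in M by rewrite !inE eq_sym ne.
have Me2 : e2 \in M by rewrite !inE De2 andbT; apply: contraNneq c02 => ->.
have P2 : 1 < #|P|.
  by apply/card_gt1P; exists (c e1), (c e2); split; rewrite ?imset_f // -c01 eq_sym.
(* Two edges of [M] share a centre, so there are fewer than [t] stars; with at least two stars this
   also gives [3 <= t]. *)
have Pt : #|P| < t.
  rewrite -(card_D1 _ De0) ltn_neqAle leq_imset_card andbT.
  by apply/negP=> /imset_injP; apply: c_ninj.
have [T [T_inj memT T_sorted T_sum]] := sorted_tuple_enumeration P r.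
have TP i : tnth T i \in P by rewrite -memT mem_tnth.
have sumr : \sum_(u in P) r u = t.
  rewrite -(card_D1 _ De0) -sum1_card (partition_big_imset c) /=.
  by apply: eq_bigr => u _; rewrite /r -sum1_card; apply: eq_bigl => e; rewrite inE.
have /tnthP[j cj] : c e0 \in T by rewrite memT c01 imset_f.
have Kcentre i : star_centre (star_block l c M (tnth T i)) (tnth (map_tuple r T) i) (tnth T i).
  by rewrite tnth_map; exact: (star_system_star_centre lcD l_inj _ (sD e0)).
have := C4 (leq_ltn_trans P2 Pt) #|P| _ (map_tuple r T) _ T_sorted _ M (eop_subset (sD e0) Deop)
  (card_D1 _ De0) (fun i => star_block l c M (tnth T i)) _ _ _ (l e0) (lN _ De0) j (c e0) _ _.
case.
- by rewrite P2 subn1 /=; lia.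
- move=> i; rewrite tnth_map; have /imsetP[e Me ->] := TP i.
  by apply/card_gt0P; exists e; rewrite inE Me eqxx.
- by rewrite T_sum.
- by move=> i i' /(star_block_inj lcD (sD e0) (TP i) (TP i'))/T_inj.
- rewrite (star_system_components lcD lcE (sD e0)).
  apply/setP=> C; apply/imsetP/imsetP=> [[i _ ->]|[u Pu ->]]; first by exists (tnth T i); [apply: TP|].
  by rewrite -memT in Pu; case/tnthP: Pu => i ->; exists i.
- by move=> i; apply: star_centre_isomorphic (Kcentre i).
- by rewrite [X in star_centre _ _ X]cj; apply: Kcentre.
- exact: (star_system_adj lcD).
move=> v /setD1P[/eqP nv vM] a; exact: nv (nbr _ _ De0 vM a).
Qed.

Theorem theorem2p3 (G : sgraph) (t : nat) :
  connected_graph G -> 2 <= t ->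
  (2 <= eop_number G <= t) <->
  [/\ (* C1 *)
      2 <= diam G <= 2 * t,
      (* C2 *)
      forall s : nat, t + 1 <= s -> ~ has_induced G (star s),
      (* C3 *)
      forall M : {set {set G}}, induced_matching M -> #|M| = t ->
        forall z : G, z \notin cover M ->
          2 <= #|[set v in cover M | adj z v]|
    & (* C4 *)
      3 <= t ->
      forall s : nat, 2 <= s <= t - 1 ->
      forall r : s.-tuple nat,
        (forall i : 'I_s, 1 <= tnth r i) -> sorted leq r ->
        \sum_(i < s) tnth r i = t ->
      forall D : {set {set G}}, eop D -> #|D| = t ->
      forall C : 'I_s -> {set G},
        injective C -> [set C i | i : 'I_s] = components (cover D) ->
        (forall i : 'I_s, isomorphic (induced (C i)) (star (tnth r i))) ->
      forall z : G, z \notin cover D ->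
      forall (j : 'I_s) (u : G),
        star_centre (C j) (tnth r j) u -> adj z u ->
        exists2 v : G, v \in cover D :\ u & adj z v].
Proof.
move=> Gc t2; split=> [/andP[eop2 le_t]|[/andP[diam2 _] noStar twoNbrs C4]]; last first.
  (* For the lower bound, two vertices at distance at least 2 give two consecutive edges of a
     shortest path, which form an EOP set. *)
  rewrite (eop_upper_bound Gc t2) // andbT ltnNge; apply/negP=> eop1.
  move: diam2; apply/negP; rewrite -leqNgt; apply/diam_leqP=> x y.
  rewrite leqNgt; apply/negP=> lt_d.
  by have := @geodesic_leq G Gc x y 1 lt_d; rewrite ltnNge eop1.
split.
- by rewrite diam_gt1 // diam_leq.
- move=> s lt_s /has_induced_star_leq le_s.
  by have := leq_trans lt_s (leq_trans le_s le_t); rewrite addn1 ltnn.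
- move=> M Mind Mt z zM.
  by apply: induced_matching_two_neighbours; rewrite ?Mt // (leq_trans _ t2).
move=> _ s _ r _ _ _ D Deop Dt C _ defC _ z zD j u Cu zu.
by apply: (star_centre_extension Deop _ Cu); rewrite ?Dt // -defC imset_f.
Qed.
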